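(* Let $V=\mathbb C^{2n}$, regarded as a purely odd superspace ($V=V_{\bar1}$), carry a non-degenerate skew-symmetric bilinear form $(-,-)$, let $G=\mathrm{Sp}(2n,\mathbb C)$ be its isometry group, let $d\ge1$, and let $\kappa:B_{2d}^0(\mathbb C)\to(T^{2d}(V)^* )^G$ be the linear map $D\mapsto\kappa_D$. (a) If $d\le n$, then $\mathrm{Ker}(\kappa)=0$. (b) Assume $d\ge n+1$. For a subset $S\subseteq\{1,\dots,2d\}$ with $|S|=2n+1$, a diagram $D\in B_{2d}^0$ and $\sigma\in\mathrm{Sym}(S)$, let $D(S,\sigma)=D\sigma$, where $\sigma$ is regarded as an element of $\mathrm{Sym}_{2d}$ fixing the points outside $S$. Then for all such $S$ and $D$, $$\sum_{\sigma\in\mathrm{Sym}(S)}\kappa_{D(S,\sigma)}=0,$$ and all linear relations among the $\kappa_D$ are linear consequences (i.e. linear combinations) of these relations.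
   Context: $B_{2d}^0(\mathbb C)$ is the complex vector space with basis the Brauer diagrams $2d\to0$, i.e. the partitions of $\{1,\dots,2d\}$ into $d$ pairs. $\mathrm{Sym}_{2d}$ acts on it on the right: $D\pi$ is the diagram whose pairs are $\{\pi^{-1}(a),\pi^{-1}(b)\}$ for $\{a,b\}$ a pair of $D$. $D_0$ is the diagram pairing $2i-1$ with $2i$, $i=1,\dots,d$. $T^{2d}(V)=V^{\otimes 2d}$. Since $V$ is purely odd, $\mathrm{Sym}_{2d}$ acts on $T^{2d}(V)$ by the signed action $\varpi_{2d}$, in which $(i,i+1)$ acts as minus the interchange of the $i$th and $(i+1)$th tensor factors; that is, $\varpi_{2d}(\pi)(v_1\otimes\dots\otimes v_{2d})=\varepsilon(\pi)\,v_{\pi^{-1}(1)}\otimes\dots\otimes v_{\pi^{-1}(2d)}$, $\varepsilon$ being the sign character. For $\underline v=v_1\otimes\dots\otimes v_{2d}$ let $\langle\underline v\rangle_0=(v_1,v_2)(v_3,v_4)\cdots(v_{2d-1},v_{2d})$. For a diagram $D$, $\kappa_D(\underline v):=\langle\varpi_{2d}(\pi)(\underline v)\rangle_0$ for any $\pi\in\mathrm{Sym}_{2d}$ with $D=D_0\pi$; this is independent of the choice of $\pi$, and $\kappa_D\in(T^{2d}(V)^* )^G$. *)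

(* Defs.v *)
From HB Require Import structures.
From mathcomp Require Import all_boot all_order all_fingroup all_algebra.
From mathcomp Require Import boolp.

Set Implicit Arguments.
Unset Strict Implicit.
Unset Printing Implicit Defensive.

Import GRing.Theory.
Local Open Scope ring_scope.

Section VspaceOfProp.
Variables (K : fieldType) (vT : vectType K).

Lemma vspace_of_prop (P : vT -> Prop) :
    P 0 -> (forall a u v, P u -> P v -> P (a *: u + v)) ->
  exists U : {vspace vT}, forall v, v \in U <-> P v.
Proof.
move=> P0 PD.
pose Q k := `[< exists2 U : {vspace vT}, \dim U = k & forall v, v \in U -> P v >].
have exQ : exists k, Q k.
  by exists 0; apply/asboolP; exists 0%VS; rewrite ?dimv0 // => v; rewrite memv0 => /eqP->.
have ubQ k : Q k -> (k <= dim vT)%N.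
  by move=> /asboolP[U <- _]; rewrite -dimvf; apply/dimvS/subvf.
case: (ex_maxnP exQ ubQ) => k /asboolP[U dimU UP] maxk.
exists U => v; split=> [|Pv]; first exact: UP.
have UvP w : w \in (U + <[v]>)%VS -> P w.
  case/memv_addP => u uU [_ /vlineP[a ->] ->].
  by rewrite addrC; apply: PD => //; apply: UP.
have /maxk : Q (\dim (U + <[v]>)) by apply/asboolP; exists (U + <[v]>)%VS.
rewrite -dimU => le_dim.
have /eqP-> : U == (U + <[v]>)%VS by rewrite eqEdim addvSl.
by apply: (subvP (addvSr U <[v]>)); apply: memv_line.
Qed.

End VspaceOfProp.

Section Tensor.
Variables (K : fieldType) (N m : nat).
Local Notation V := 'rV[K]_N.

(* The tensor power of V = K^N, as the free K-module on the words            *)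
(* e_(I 0) (x) ... (x) e_(I (m - 1)) in the standard basis of V; [pure v] is  *)
(* v_0 (x) ... (x) v_(m - 1).                                                 *)
Definition tensor := {ffun {ffun 'I_m -> 'I_N} -> K^o}.

Definition pure (v : {ffun 'I_m -> V}) : tensor :=
  [ffun I : {ffun 'I_m -> 'I_N} => \prod_k v k 0 (I k)].

Definition basis_word (I : {ffun 'I_m -> 'I_N}) : {ffun 'I_m -> V} :=
  [ffun k => delta_mx 0 (I k)].

Definition upd (v : {ffun 'I_m -> V}) (j : 'I_m) (x : V) : {ffun 'I_m -> V} :=
  [ffun k => if k == j then x else v k].

Definition multilinear (W : vectType K) (phi : {ffun 'I_m -> V} -> W) : Prop :=
  forall v j a x y, phi (upd v j (a *: x + y)) =
                    a *: phi (upd v j x) + phi (upd v j y).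

(* The linear map induced by a multilinear map (see tlift_pure). *)
Definition tlift (W : vectType K) (phi : {ffun 'I_m -> V} -> W) : 'Hom(tensor, W) :=
  linfun (fun t : tensor => \sum_I t I *: phi (basis_word I)).

Lemma tliftE (W : vectType K) (phi : {ffun 'I_m -> V} -> W) t :
  tlift phi t = \sum_I t I *: phi (basis_word I).
Proof.
pose f := fun t : tensor => \sum_I t I *: phi (basis_word I).
have fL : linear f.
  move=> a u v; rewrite /f scaler_sumr -big_split; apply: eq_bigr => I _ /=.
  by rewrite !ffunE scalerDl scalerA.
pose fM := GRing.isLinear.Build _ _ _ _ f fL.
pose fl : {linear _ -> _} := HB.pack f fM.
exact: (lfunE fl).
Qed.

Lemma multilinear_eq (W : vectType K) (phi psi : {ffun 'I_m -> V} -> W) :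
    multilinear phi -> multilinear psi ->
    (forall I, phi (basis_word I) = psi (basis_word I)) -> phi =1 psi.
Proof.
move=> phiM psiM eqB.
pose Q j := forall v : {ffun 'I_m -> V},
  (forall k : 'I_m, (j <= k)%N -> exists i, v k = delta_mx 0 i) -> phi v = psi v.
suff Qj : forall j, (j <= m)%N -> Q j.
  by move=> v; apply: (Qj m) => // k; rewrite leqNgt ltn_ord.
elim=> [_ v vB|j IHj ltjm v vB].
  have vB' k : exists i, v k == delta_mx 0 i.
    by have [//|i ->] := vB k; exists i.
  pose I := [ffun k => xchoose (vB' k)].
  suff -> : v = basis_word I by [].
  by apply/ffunP=> k; rewrite !ffunE; apply/eqP/(xchooseP (vB' k)).
pose oj := Ordinal ltjm.
have -> : v = upd v oj (v oj) by apply/ffunP=> k; rewrite ffunE; case: eqP => // ->.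
have upd0 (f : {ffun 'I_m -> V} -> W) : multilinear f -> f (upd v oj 0) = 0.
  move=> fM; have := fM v oj 1 0 0; rewrite !scale1r addr0 => /eqP.
  by rewrite -subr_eq0 opprD addNKr oppr_eq0 => /eqP.
have updS (f : {ffun 'I_m -> V} -> W) : multilinear f ->
    f (upd v oj (v oj)) = \sum_i v oj 0 i *: f (upd v oj (delta_mx 0 i)).
  move=> fM; rewrite [in LHS](row_sum_delta (v oj)).
  elim: (index_enum _) => [|i s IHs]; first by rewrite !big_nil upd0.
  by rewrite !big_cons fM IHs.
rewrite !updS //; apply: eq_bigr => i _; congr (_ *: _).
apply: IHj => [|k lejk]; first exact: ltnW.
rewrite ffunE; case: eqP => [_|/eqP nekj]; first by exists i.
by apply: vB; rewrite ltn_neqAle lejk andbT eq_sym.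
Qed.

Lemma prod_upd (v : {ffun 'I_m -> V}) j x (I : {ffun 'I_m -> 'I_N}) :
  \prod_k upd v j x k 0 (I k) = x 0 (I j) * \prod_(k | k != j) v k 0 (I k).
Proof.
rewrite (bigD1 j) //= ffunE eqxx; congr (_ * _).
by apply: eq_bigr => k /negPf nekj; rewrite ffunE nekj.
Qed.

Lemma pure_multilinear : multilinear pure.
Proof.
move=> v j a x y; apply/ffunP=> I; rewrite !ffunE !prod_upd !mxE.
by rewrite mulrDl -mulrA.
Qed.

Lemma pure_basis I J : pure (basis_word I) J = (J == I)%:R.
Proof.
rewrite ffunE; have [->|neJI] := eqVneq J I.
  by rewrite big1 // => k _; rewrite ffunE mxE !eqxx.
have [k neq] : exists k, J k != I k.
  by apply/existsP; apply: contraNT neJI => /existsPn eqJI; apply/eqP/ffunP=> k; apply/eqP/negPn.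
by rewrite (bigD1 k) //= ffunE mxE eqxx (negPf neq) mul0r.
Qed.

Lemma tensor_decomp (t : tensor) : t = \sum_I t I *: pure (basis_word I).
Proof.
apply/ffunP=> J; rewrite sum_ffunE (bigD1 J) //= ffunE pure_basis eqxx.
rewrite /GRing.scale /= mulr1 big1 ?addr0 // => I /negPf neIJ.
by rewrite ffunE pure_basis eq_sym neIJ scaler0.
Qed.

Lemma tlift_pure (W : vectType K) (phi : {ffun 'I_m -> V} -> W) v :
  multilinear phi -> tlift phi (pure v) = phi v.
Proof.
move=> phiM; pose psi v := tlift phi (pure v).
apply: (@multilinear_eq _ psi phi) => // [u j a x y|I].
  by rewrite /psi pure_multilinear linearP.
rewrite /psi tliftE (bigD1 I) //= pure_basis eqxx scale1r big1 ?addr0 // => J.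
by rewrite pure_basis => /negPf->; rewrite scale0r.
Qed.

Lemma tensor_hom_eq (W : vectType K) (f g : 'Hom(tensor, W)) :
  (forall v, f (pure v) = g (pure v)) -> f = g.
Proof.
move=> fg; apply/lfunP=> t; rewrite (tensor_decomp t) !linear_sum.
by apply: eq_bigr => I _; rewrite !linearZ /= fg.
Qed.

Definition tensor_map (g : 'End(V)) : 'End(tensor) :=
  tlift (fun v => pure [ffun k => g (v k)]).

Lemma tensor_map_pure g v : tensor_map g (pure v) = pure [ffun k => g (v k)].
Proof.
apply: tlift_pure => u j a x y.
have E z : [ffun k => g (upd u j z k)] = upd [ffun k => g (u k)] j (g z).
  by apply/ffunP=> k; rewrite !ffunE; case: eqP.
by rewrite !E linearP pure_multilinear.
Qed.

(* The signed action of the symmetric group: the sign is the one of the tensor *)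
(* powers of a purely odd superspace.                                          *)
Definition varpi (s : 'S_m) : 'End(tensor) :=
  tlift (fun v => (-1) ^+ s *: pure [ffun k => v ((s^-1)%g k)]).

Lemma varpi_pure s v : varpi s (pure v) = (-1) ^+ s *: pure [ffun k => v ((s^-1)%g k)].
Proof.
apply: (@tlift_pure _ (fun v => _ *: pure [ffun k => v ((s^-1)%g k)])) => u j a x y.
have E z : [ffun k => upd u j z ((s^-1)%g k)] = upd [ffun k => u ((s^-1)%g k)] (s j) z.
  by apply/ffunP=> k; rewrite !ffunE (canF_eq (permKV s)).
by rewrite !E pure_multilinear scalerDr !scalerA mulrC.
Qed.

End Tensor.

Section BrauerDiagrams.
Variable d : nat.

Lemma pt_subproof (i : 'I_d) (b : bool) : (2 * i + b < 2 * d)%N.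
Proof.
apply: (@leq_trans (2 * i.+1)); last by rewrite leq_pmul2l.
by rewrite mulnS addnC -addSn leq_add2r; case: b.
Qed.

(* Positions are numbered from 0: [pt i false] = 2i and [pt i true] = 2i + 1. *)
Definition pt (i : 'I_d) (b : bool) : 'I_(2 * d) := Ordinal (pt_subproof i b).

Lemma pt_inj i j b c : pt i b = pt j c -> i = j /\ b = c.
Proof.
move=> /(congr1 val) /= eqv.
have eqb : b = c.
  by have := congr1 odd eqv; rewrite !mul2n !oddD !odd_double; case: b c {eqv} => [] [].
split=> //; apply: val_inj; move/eqP: eqv.
by rewrite eqb eqn_add2r eqn_pmul2l // => /eqP.
Qed.

Lemma ptP (k : 'I_(2 * d)) : {ib : 'I_d * bool | k = pt ib.1 ib.2}.
Proof.
have lt_k : (k./2 < d)%N by rewrite ltn_half_double -mul2n.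
exists (Ordinal lt_k, odd k); apply: val_inj => /=.
by rewrite -[LHS]odd_double_half addnC -mul2n.
Qed.

Definition is_brauer (P : {set {set 'I_(2 * d)}}) : bool :=
  partition P [set: 'I_(2 * d)] && [forall b in P, #|b| == 2].

Record brauer := Brauer {
  brauer_pairs : {set {set 'I_(2 * d)}};
  _ : is_brauer brauer_pairs }.

HB.instance Definition _ := [isSub for brauer_pairs].
HB.instance Definition _ := [Finite of brauer by <:].

Lemma brauer0_subproof : is_brauer [set [set pt i false; pt i true] | i : 'I_d].
Proof.
apply/andP; split; last first.
  apply/'forall_implyP => _ /imsetP[i _ ->]; rewrite cards2.
  by case: (pt i false =P pt i true) => // /pt_inj[].
apply/and3P; split.
- apply/eqP/setP=> k; rewrite inE; have [[i b] ->] := ptP k.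
  apply/bigcupP; exists [set pt i false; pt i true]; first exact: imset_f.
  by rewrite !inE /=; case: b; rewrite eqxx ?orbT.
- apply/trivIsetP => _ _ /imsetP[i _ ->] /imsetP[j _ ->] neij.
  rewrite -setI_eq0; apply: contraNT neij => /set0Pn[k].
  rewrite !inE => /andP[/orP[]/eqP-> /orP[]/eqP/pt_inj[eqij _]]; by rewrite eqij.
- by apply/imsetP => -[i _ /setP/(_ (pt i false))]; rewrite !inE eqxx.
Qed.

Definition brauer0 : brauer := Brauer brauer0_subproof.

Lemma brauer_act_subproof (D : brauer) (s : 'S_(2 * d)) :
  is_brauer [set (s^-1)%g @: b | b : {set _} in brauer_pairs D].
Proof.
case: D => P /= /andP[/and3P[/eqP covP trivP P0] /'forall_implyP cardP].
have sI : injective (s^-1)%g by apply: perm_inj.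
apply/andP; split; last first.
  by apply/'forall_implyP => _ /imsetP[b bP ->]; rewrite card_imset //; apply: cardP.
apply/and3P; split.
- apply/eqP/setP=> k; rewrite inE.
  have : s k \in cover P by rewrite covP inE.
  case/bigcupP=> b bP skb; apply/bigcupP; exists ((s^-1)%g @: b); first exact: imset_f.
  by apply/imsetP; exists (s k) => //; rewrite permK.
- apply/trivIsetP => _ _ /imsetP[b bP ->] /imsetP[c cP ->] nebc.
  rewrite -setI_eq0 -imsetI; last by move=> ? ? _ _; apply: sI.
  have /trivIsetP/(_ b c bP cP) := trivP.
  have nebc' : b != c by apply: contraNneq nebc => ->.
  by move=> /(_ nebc'); rewrite -setI_eq0 => /eqP->; rewrite imset0.
- apply/imsetP => -[b bP /esym/eqP]; rewrite imset_eq0 => /eqP b0.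
  by rewrite -b0 bP in P0.
Qed.

(* The diagram D s. In MathComp (s * t) x = t (s x), hence the order of the *)
(* product in brauer_actM.                                                 *)
Definition brauer_act (D : brauer) (s : 'S_(2 * d)) : brauer :=
  Brauer (brauer_act_subproof D s).

Lemma brauer_act1 D : brauer_act D 1 = D.
Proof.
apply/val_inj/setP=> b /=; rewrite invg1; apply/imsetP/idP => [[c cD ->]|bD].
  by have -> : (1%g : 'S_(2 * d)) @: c = c by rewrite -[RHS]imset_id; apply: eq_imset => x; rewrite perm1.
by exists b => //; rewrite -[LHS]imset_id; apply: eq_imset => x; rewrite perm1.
Qed.

Lemma brauer_actM D s t : brauer_act (brauer_act D s) t = brauer_act D (t * s).
Proof.
apply: val_inj => /=; rewrite -imset_comp; apply: eq_imset => b /=.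
by rewrite -imset_comp; apply: eq_imset => x /=; rewrite invMg permM.
Qed.

Lemma brauer0_actE s :
  brauer_pairs (brauer_act brauer0 s) =
  [set [set (s^-1)%g (pt i false); (s^-1)%g (pt i true)] | i : 'I_d].
Proof.
by rewrite /= -imset_comp; apply: eq_imset => i /=; rewrite imsetU1 imset_set1.
Qed.

Lemma brauer_transitive (D : brauer) : exists s, D = brauer_act brauer0 s.
Proof.
case: D => P PB; have /andP[partP /'forall_implyP cardP] := PB.
have cP : #|P| = d.
  have /(card_uniform_partition (n := 2)) : {in P, forall b : {set _}, #|b| = 2}.
    by move=> b bP; apply/eqP/cardP.
  move=> /(_ _ partP); rewrite cardsT card_ord => /eqP.
  by rewrite [X in _ == X]mulnC eqn_pmul2l // => /eqP/esym.
pose bl (i : 'I_d) : {set 'I_(2 * d)} := enum_val (cast_ord (esym cP) i).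
have blP i : bl i \in P by apply: enum_valP.
have bl2 i : exists xy, (xy.1 != xy.2) && (bl i == [set xy.1; xy.2]).
  have /cards2P[x [y [nexy eqb]]] := cardP _ (blP i).
  by exists (x, y); rewrite /= nexy eqb eqxx.
pose f (k : 'I_(2 * d)) :=
  let ib := sval (ptP k) in let xy := xchoose (bl2 ib.1) in
  if ib.2 then xy.2 else xy.1.
have fE i b : f (pt i b) = if b then (xchoose (bl2 i)).2 else (xchoose (bl2 i)).1.
  by rewrite /f; case: (ptP _) => -[j c] /= /pt_inj[-> ->].
have blf i : bl i = [set f (pt i false); f (pt i true)].
  by rewrite !fE; have /andP[_ /eqP] := xchooseP (bl2 i).
have f_in i b : f (pt i b) \in bl i.
  by rewrite blf !inE; case: b; rewrite eqxx ?orbT.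
have fI : injective f.
  move=> k l; have [[i b] ->] := ptP k; have [[j c] ->] := ptP l => /= eqf.
  have /and3P[_ trivP _] := partP.
  have eqij : i = j.
    apply/eqP; apply: contraTT isT => neij.
    have neb : bl i != bl j.
      by apply: contraNneq neij => /enum_val_inj/cast_ord_inj->.
    have /trivIsetP/(_ _ _ (blP i) (blP j) neb) := trivP.
    by rewrite -setI_eq0 => /eqP/setP/(_ (f (pt i b))); rewrite !inE f_in eqf f_in.
  subst j; have /andP[nexy _] := xchooseP (bl2 i).
  by move: eqf; rewrite !fE; case: b c => [] [] // /eqP; rewrite ?(negPf nexy) // eq_sym (negPf nexy).
exists (perm fI)^-1%g; apply/val_inj; rewrite [RHS]brauer0_actE invgK /=.
apply/setP=> b; apply/idP/imsetP => [bP|[i _ ->]]; last by rewrite !permE -blf.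
exists (cast_ord cP (enum_rank_in bP b)) => //.
by rewrite !permE -blf /bl cast_ordK enum_rankK_in.
Qed.

(* Some permutation s with D = D_0 s; kappa_form_brauer0_act shows that the   *)
(* choice is irrelevant.                                                      *)
Definition perm_of_brauer (D : brauer) : 'S_(2 * d) :=
  odflt 1%g [pick s | D == brauer_act brauer0 s].

Lemma perm_of_brauerK D : brauer_act brauer0 (perm_of_brauer D) = D.
Proof.
rewrite /perm_of_brauer; case: pickP => [s /eqP-> //|] noD.
by have [s /eqP] := brauer_transitive D; rewrite noD.
Qed.

End BrauerDiagrams.

Section BlockPermSign.
Variable d : nat.

Let liftf (f : 'I_d * bool -> 'I_d * bool) (k : 'I_(2 * d)) : 'I_(2 * d) :=
  let ib := f (sval (ptP k)) in pt ib.1 ib.2.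

Let liftfE f i b : liftf f (pt i b) = pt (f (i, b)).1 (f (i, b)).2.
Proof. by rewrite /liftf; case: (ptP _) => -[j c] /= /pt_inj[-> ->]. Qed.

Let liftf_inj f : injective f -> injective (liftf f).
Proof.
move=> fI k l; have [[i b] ->] := ptP k; have [[j c] ->] := ptP l => /=.
rewrite !liftfE => /pt_inj[e1 e2].
have [-> ->] // : (i, b) = (j, c).
by apply: fI; rewrite [LHS]surjective_pairing [RHS]surjective_pairing e1 e2.
Qed.

Let flip (fl : 'I_d -> bool) (s : seq 'I_d) : 'S_(2 * d) :=
  (\prod_(j <- s) if fl j then tperm (pt j false) (pt j true) else 1)%g.

Let flipE fl s i b :
  uniq s -> flip fl s (pt i b) = pt i (b (+) ((i \in s) && fl i)).
Proof.
rewrite /flip; elim: s i b => [|j s IHs] i b /=; first by rewrite big_nil perm1 addbF.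
case/andP=> js us; rewrite big_cons permM in_cons.
have [->|neij] := eqVneq i j.
  case: (fl j); last by rewrite perm1 IHs // (negPf js) andbF.
  have -> : tperm (pt j false) (pt j true) (pt j b) = pt j (~~ b).
    by case: b; rewrite ?tpermL ?tpermR.
  by rewrite IHs // (negPf js) /= addbF addbT.
case: (fl j); last by rewrite perm1 IHs.
by rewrite tpermD ?IHs //; apply/eqP => /pt_inj[/eqP]; rewrite eq_sym (negPf neij).
Qed.

Let odd_flip fl s : flip fl s = \big[addb/false]_(j <- s) fl j :> bool.
Proof.
rewrite /flip; elim: s => [|j s IHs]; first by rewrite !big_nil odd_perm1.
rewrite !big_cons odd_permM IHs; congr (_ (+) _).
case: (fl j); rewrite ?odd_perm1 // odd_tperm.
by apply/eqP => /pt_inj[].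
Qed.

Lemma odd_block_perm (r : 'S_(2 * d)) (rho : 'I_d -> 'I_d) (fl : 'I_d -> bool) :
    (forall i b, r (pt i b) = pt (rho i) (b (+) fl i)) ->
  r = \big[addb/false]_i fl i :> bool.
Proof.
move=> rE.
have rhoI : injective rho.
  move=> i j eqij; have : r (pt i (fl i)) = r (pt j (fl j)) by rewrite !rE !addbb eqij.
  by move/perm_inj/pt_inj => [].
pose half c (ib : 'I_d * bool) := if ib.2 == c then (rho ib.1, ib.2) else ib.
have halfI c : injective (half c).
  move=> [i b] [j e]; rewrite /half /=.
  case: (b =P c) => [->|neb]; case: (e =P c) => [->|nee] //.
  - by case=> /rhoI->.
  - by case=> _ eqc; case: nee.
  - by case=> _ eqc; case: neb.
pose A c := perm (liftf_inj (halfI c)).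
have AE c i b : A c (pt i b) = if b == c then pt (rho i) b else pt i b.
  by rewrite permE liftfE /half /=; case: ifP.
pose om := flip xpredT (index_enum 'I_d).
have omE i b : om (pt i b) = pt i (~~ b).
  by rewrite flipE ?index_enum_uniq // mem_index_enum addbT.
have omA : (A true * om = om * A false)%g.
  apply/permP => k; have [[i b] ->] := ptP k.
  by rewrite !permM /= omE !AE; case: b; rewrite /= omE.
have oddA : odd_perm (A true) = odd_perm (A false).
  by have := congr1 (@odd_perm _) omA; rewrite !odd_permM addbC => /addbI.
have -> : r = (flip fl (index_enum 'I_d) * (A false * A true))%g.
  apply/permP => k; have [[i b] ->] := ptP k.
  rewrite !permM /= flipE ?index_enum_uniq // mem_index_enum rE /= AE.
  by case: (b (+) fl i) => /=; rewrite AE.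
by rewrite !odd_permM oddA addbb addbF odd_flip.
Qed.

End BlockPermSign.

Section Kappa.
Variables (K : fieldType) (N d : nat).
Local Notation V := 'rV[K]_N.
Local Notation T := (tensor K N (2 * d)).
Variable form : {skew_symmetric V}.

Definition isometry_group (g : 'End(V)) : Prop :=
  lker g == 0%VS /\ isometry form form g.

Definition dual_map (g : 'End(V)) (f : 'Hom(T, K^o)) : 'Hom(T, K^o) :=
  (f \o tensor_map (2 * d) (g^-1)%VF)%VF.

Lemma invariants_subproof : exists U : {vspace 'Hom(T, K^o)},
  forall f, f \in U <-> (forall g, isometry_group g -> dual_map g f = f).
Proof.
apply: vspace_of_prop => [g gG|a f1 f2 f1G f2G g gG]; first exact: comp_lfun0l.
by rewrite /dual_map comp_lfunDl -comp_lfunZl -!/(dual_map _ _) f1G ?f2G.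
Qed.

Definition invariants : {vspace 'Hom(T, K^o)} := sval (cid invariants_subproof).

Lemma invariantsP f :
  f \in invariants <-> (forall g, isometry_group g -> dual_map g f = f).
Proof. exact: (svalP (cid invariants_subproof)). Qed.

Definition contraction0 : 'Hom(T, K^o) :=
  tlift (fun v => \prod_(i < d) form (v (pt i false)) (v (pt i true)) : K^o).

Lemma contraction0_pure v :
  contraction0 (pure v) = \prod_(i < d) form (v (pt i false)) (v (pt i true)).
Proof.
apply: (@tlift_pure _ _ _ K^o) => u j a x y.
have [[i b] ->] := ptP j; rewrite !(bigD1 (P := xpredT) i) //=.
have E z : \prod_(k < d | k != i)
      form (upd u (pt i b) z (pt k false)) (upd u (pt i b) z (pt k true)) =
    \prod_(k < d | k != i) form (u (pt k false)) (u (pt k true)).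
  apply: eq_bigr => k neki.
  have neP c : (pt k c == pt i b) = false.
    by apply/eqP => /pt_inj[/eqP]; rewrite (negPf neki).
  by rewrite !ffunE !neP.
rewrite !E !ffunE -[a *: (_ * _)]/(a * (_ * _)) mulrA -mulrDl; congr (_ * _).
have neqTF : (pt i true == pt i false) = false by apply/eqP => /pt_inj[].
have neqFT : (pt i false == pt i true) = false by apply/eqP => /pt_inj[].
by case: b {E}; rewrite eqxx ?neqTF ?neqFT ?linearPl ?linearPr.
Qed.

Definition kappa_form (s : 'S_(2 * d)) : 'Hom(T, K^o) :=
  (contraction0 \o varpi K N s)%VF.

Lemma kappa_form_pure s v : kappa_form s (pure v) =
  (-1) ^+ s * \prod_(i < d) form (v ((s^-1)%g (pt i false))) (v ((s^-1)%g (pt i true))).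
Proof.
rewrite /kappa_form comp_lfunE varpi_pure linearZ /= contraction0_pure.
by congr (_ * _); apply: eq_bigr => i _; rewrite !ffunE.
Qed.

Lemma kappa_form_invariant s : kappa_form s \in invariants.
Proof.
apply/invariantsP => g [kerg isog]; apply: tensor_hom_eq => v.
rewrite /dual_map comp_lfunE tensor_map_pure !kappa_form_pure.
congr (_ * _); apply: eq_bigr => i _; rewrite !ffunE.
have gK w : g ((g^-1)%VF w) = w.
  by apply: limg_lfunVK; rewrite lker0_limgf ?memvf.
by rewrite -isog !gK.
Qed.

Lemma kappa_form_brauer0_act s t :
  brauer_act (brauer0 d) s = brauer_act (brauer0 d) t -> kappa_form s = kappa_form t.
Proof.
move=> eqD; apply: tensor_hom_eq => v; rewrite !kappa_form_pure.
have {}eqD : [set [set (s^-1)%g (pt i false); (s^-1)%g (pt i true)] | i : 'I_d] =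
             [set [set (t^-1)%g (pt i false); (t^-1)%g (pt i true)] | i : 'I_d].
  by rewrite -!brauer0_actE eqD.
have st i : exists jc : 'I_d * bool, [forall b, (s^-1)%g (pt i b) == (t^-1)%g (pt jc.1 (b (+) jc.2))].
  have : [set (s^-1)%g (pt i false); (s^-1)%g (pt i true)] \in
         [set [set (t^-1)%g (pt i false); (t^-1)%g (pt i true)] | i : 'I_d].
    by rewrite -eqD; apply: imset_f.
  case/imsetP=> j _ /setP eqij.
  have : (s^-1)%g (pt i false) != (s^-1)%g (pt i true).
    by rewrite (inj_eq perm_inj); apply/eqP => /pt_inj[].
  have := eqij ((s^-1)%g (pt i false)); have := eqij ((s^-1)%g (pt i true)).
  rewrite !inE !eqxx orbT /= => /esym/orP[]/eqP eT /esym/orP[]/eqP eF; rewrite eT eF ?eqxx // => _.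
    by exists (j, true); apply/forallP; case; rewrite /= ?eT ?eF.
  by exists (j, false); apply/forallP; case; rewrite /= ?eT ?eF.
pose rho i := (xchoose (st i)).1; pose fl i := (xchoose (st i)).2.
have sE i b : (s^-1)%g (pt i b) = (t^-1)%g (pt (rho i) (b (+) fl i)).
  by apply/eqP; have /forallP := xchooseP (st i); apply.
have rE i b : (s^-1 * t)%g (pt i b) = pt (rho i) (b (+) fl i).
  by rewrite permM sE permKV.
have rhoI : injective rho.
  move=> i j eqij; have : (s^-1 * t)%g (pt i (fl i)) = (s^-1 * t)%g (pt j (fl j)).
    by rewrite !rE !addbb eqij.
  by move/perm_inj/pt_inj => [].
have signE : (-1) ^+ s * (\prod_i (-1) ^+ fl i) = (-1) ^+ t :> K.
  have -> : \prod_i (-1) ^+ fl i = (-1) ^+ (\big[addb/false]_i fl i) :> K.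
    by apply: (big_ind2 (fun (x : K) (b : bool) => x = (-1) ^+ b)) => // x b y c -> ->; rewrite signr_addb.
  by rewrite -(odd_block_perm rE) -signr_addb odd_permM odd_permV addKb.
rewrite -signE -mulrA; congr (_ * _).
rewrite [X in _ = _ * X](reindex_inj rhoI) -big_split; apply: eq_bigr => i _ /=.
rewrite !sE; case: (fl i); rewrite /= ?mul1r //.
by rewrite expr1 mulN1r hermC expr1 mulN1r.
Qed.

(* kappa_D, as an element of the space of invariants *)
Definition kappa_diag (D : brauer d) : subvs_of invariants :=
  Subvs (kappa_form_invariant (perm_of_brauer D)).

Lemma kappa_diagE D s : D = brauer_act (brauer0 d) s ->
  vsval (kappa_diag D) = kappa_form s.
Proof.
by move=> DE; apply: kappa_form_brauer0_act; rewrite perm_of_brauerK.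
Qed.

Definition kappa : 'Hom({ffun brauer d -> K^o}, subvs_of invariants) :=
  linfun (fun x : {ffun brauer d -> K^o} => \sum_D (x D : K) *: kappa_diag D).

Lemma kappaE x : kappa x = \sum_D (x D : K) *: kappa_diag D.
Proof.
pose f := fun x : {ffun brauer d -> K^o} => \sum_D (x D : K) *: kappa_diag D.
have fL : linear f.
  move=> a u v; rewrite /f scaler_sumr -big_split; apply: eq_bigr => D _ /=.
  by rewrite !ffunE scalerDl scalerA.
pose fM := GRing.isLinear.Build _ _ _ _ f fL.
pose fl : {linear _ -> _} := HB.pack f fM.
exact: (lfunE fl).
Qed.

Definition brauer_vec (D : brauer d) : {ffun brauer d -> K^o} :=
  [ffun E => (E == D)%:R].

Lemma kappa_brauer_vec D : kappa (brauer_vec D) = kappa_diag D.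
Proof.
rewrite kappaE (bigD1 D) //= ffunE eqxx scale1r big1 ?addr0 // => E.
by rewrite ffunE => /negPf->; rewrite scale0r.
Qed.

(* The element of the diagram space that expresses the relation attached to S *)
(* and D.                                                                     *)
Definition brauer_relation (S : {set 'I_(2 * d)}) (D : brauer d) :
    {ffun brauer d -> K^o} :=
  \sum_(s in Sym S) brauer_vec (brauer_act D s).

End Kappa.

Arguments kappa_diag {K N d} form D.
Arguments kappa {K N} d form.
Arguments brauer_relation {K d} S D.

(* Main.v *)
Require Import Defs.
From mathcomp Require Import all_boot all_order all_fingroup all_algebra.
From mathcomp Require Import complex reals.

(* Order the diagrams by the lexicographic order of the words (D(1), ..., D(2d)), where D(k) is
   the point paired with k.
   - If D contains n + 1 nested arcs, the relation attached to 2n + 1 of their 2n + 2 end points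
     is a positive multiple of D plus diagrams that are lexicographically smaller: nested arcs
     are the largest way to pair up their end points. So, modulo the relations, every element is
     a combination of diagrams without n + 1 nested arcs.
   - If D has no n + 1 nested arcs, colouring each arc by its nesting depth uses only n colours.
     Put e_c at the left end and f_c at the right end of the arcs of colour c, where the (e_c, f_c)
     are orthogonal hyperbolic pairs. Then kappa_D does not vanish on this tensor, and kappa_E
     vanishes on it unless E = D or E is larger than D: E must pair left ends with right ends
     within each colour, and D does so in the smallest way. So the kappa_D of these diagrams are
     linearly independent. *)

Set Implicit Arguments.
Unset Strict Implicit.
Unset Printing Implicit Defensive.

Import GRing.Theory.
Local Open Scope ring_scope.
Local Open Scope complex_scope.

(** * Diagrams as involutions, their lexicographic order, and nested arcs *)

Section Mate.
Variable d : nat.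
Implicit Types (D E : brauer d) (k l : 'I_(2 * d)).

Definition flip_pt k : 'I_(2 * d) :=
  let ib := sval (ptP k) in pt ib.1 (~~ ib.2).

Lemma flip_ptE (i : 'I_d) b : flip_pt (pt i b) = pt i (~~ b).
Proof. by rewrite /flip_pt; case: ptP => -[j c] /= /pt_inj[-> ->]. Qed.

Lemma flip_ptK : involutive flip_pt.
Proof. by move=> k; have [[i b] ->] := ptP k; rewrite !flip_ptE negbK. Qed.

Lemma flip_pt_neq k : flip_pt k != k.
Proof.
by have [[i b] ->] := ptP k; rewrite flip_ptE; apply/eqP=> /pt_inj[_]; case: b.
Qed.

(** The fixed-point-free involution whose orbits are the pairs of [D], obtained by conjugating that
    of D_0; by [mem_brauer_pairs] it depends on [D] only. *)
Definition mate D k : 'I_(2 * d) :=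
  let s := perm_of_brauer D in (s^-1)%g (flip_pt (s k)).

Lemma mateK D : involutive (mate D).
Proof. by move=> k; rewrite /mate permKV flip_ptK permK. Qed.

Lemma mate_inj D : injective (mate D).
Proof. exact: inv_inj (@mateK D). Qed.

Lemma mate_neq D k : mate D k != k.
Proof.
rewrite /mate; set s := perm_of_brauer D; apply: contra_neq (flip_pt_neq (s k)).
by move=> e; rewrite -[RHS]/(s k) -[in RHS]e permKV.
Qed.

Lemma mem_brauer_pairs D k l :
  k != l -> ([set k; l] \in brauer_pairs D) = (mate D k == l).
Proof.
move=> nekl; rewrite -{1}(perm_of_brauerK D) brauer0_actE /mate.
set s := perm_of_brauer D; apply/imsetP/eqP => [[i _ /setP eqkl]|<-].
  have : k \in [set k; l] by rewrite !inE eqxx.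
  have : l \in [set k; l] by rewrite !inE eqxx orbT.
  rewrite !eqkl !inE => /orP[]/eqP el /orP[]/eqP ek; move: nekl;
    rewrite ?el ek ?eqxx // permKV flip_ptE //.
have [[i b] skE] := ptP (s k); exists i => //.
have -> : k = (s^-1)%g (pt i b) by rewrite -skE permK.
by rewrite permKV flip_ptE; case: b {skE} => //=; rewrite setUC.
Qed.

Lemma mate_act D (t : 'S_(2 * d)) k :
  mate (brauer_act D t) k = (t^-1)%g (mate D (t k)).
Proof.
have ne : t k != mate D (t k) by rewrite eq_sym mate_neq.
apply/eqP; rewrite -mem_brauer_pairs; last first.
  by apply: contra_neq ne => {1}->; rewrite permKV.
apply/imsetP; exists [set t k; mate D (t k)].
  by rewrite mem_brauer_pairs.
by rewrite imsetU1 imset_set1 permK.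
Qed.

Lemma eq_mate D E : mate D =1 mate E -> D = E.
Proof.
move=> eqDE; apply/val_inj/setP => b; change ((b \in brauer_pairs D) = (b \in brauer_pairs E)).
have [/cards2P[x [y [nexy ->]]]|nb2] := boolP (#|b| == 2).
  by rewrite !mem_brauer_pairs // eqDE.
have noF F : (b \in brauer_pairs F) = false.
  apply: contraNF nb2; case: F => P /= /andP[_ /'forall_implyP cardP].
  exact: cardP.
by rewrite !noF.
Qed.

(** A point before [k] has the same partner in both diagrams, so if one of the three points lay
    before [k], the diagrams would already agree at [k]. *)
Lemma first_difference D E k :
    (forall j : 'I_(2 * d), (j < k)%N -> mate D j = mate E j) -> mate D k != mate E k ->
  [/\ (k < mate D k)%N, (k < mate E k)%N & (k < mate D (mate E k))%N].
Proof.
move=> agree neDE.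
have later (j : 'I_(2 * d)) : k != j -> (j < k -> mate D k = mate E k)%N -> (k < j)%N.
  move=> nekj notlt; rewrite ltn_neqAle nekj leqNgt /=.
  by apply: contra neDE => /notlt ->.
split.
- apply: later; first by rewrite eq_sym mate_neq.
  by move=> /agree; rewrite mateK => {2}->; rewrite mateK.
- apply: later; first by rewrite eq_sym mate_neq.
  by move=> /agree; rewrite mateK => {1}<-; rewrite mateK.
- apply: later; first by apply: contra_neq neDE => {1}->; rewrite mateK.
  by move=> /agree; rewrite mateK => /mate_inj {1}->; rewrite mateK.
Qed.

Definition mate_word D : (2 * d).-tuplelexi 'I_(2 * d) :=
  [tuple mate D k | k < 2 * d].

Lemma mate_word_lt D E : D != E ->
    (forall k, (forall j : 'I_(2 * d), (j < k)%N -> mate D j = mate E j) ->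
       mate D k != mate E k -> (mate D k < mate E k)%N) ->
  (mate_word D < mate_word E)%O.
Proof.
move=> neDE lt_first.
have [k0 nek0] : exists k, mate D k != mate E k.
  apply/existsP; apply: contraNT neDE => /existsPn eqDE.
  by apply/eqP/eq_mate => k; apply/eqP/negPn/eqDE.
case: (@arg_minnP _ k0 (fun k => mate D k != mate E k) val nek0) => k nek mink.
have agree (j : 'I_(2 * d)) : (j < k)%N -> mate D j = mate E j.
  by move=> ltjk; apply/eqP; apply: contraLR ltjk; rewrite -leqNgt; apply: mink.
apply/ltxi_tuplePlt; exists k; last by rewrite !tnth_mktuple; apply: lt_first.
by move=> j ltjk; rewrite !tnth_mktuple agree.
Qed.

(* [k] is the left end of the innermost of [r + 1] nested arcs of [D]. *)
Fixpoint nested D (r : nat) k : bool :=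
  (k < mate D k)%N &&
  if r is r'.+1 then
    [exists l : 'I_(2 * d), [&& (l < k)%N, (mate D k < mate D l)%N & nested D r' l]]
  else true.

(** [P] collects the end points of the nested arcs. The last clause, that each arc of [P] encloses
    or equals the arc at [k], drives the induction: a new innermost arc is disjoint from [P] and
    lies inside all its arcs. *)
Lemma nested_setP D r k : nested D r k -> exists P : {set 'I_(2 * d)},
  [/\ #|P| = (2 * r.+1)%N, forall i, (mate D i \in P) = (i \in P),
      {in P &, forall i j : 'I_(2 * d), (i < mate D i -> j < mate D j -> i < j ->
         mate D j < mate D i)%N}
    & {in P, forall i : 'I_(2 * d), (i < mate D i -> i <= k /\ mate D k <= mate D i)%N}].
Proof.
elim: r k => [|r IHr] k /andP[lt_k].
  move=> _; have openE (i : 'I_(2 * d)) :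
      i \in [set k; mate D k] -> (i < mate D i)%N -> i = k.
    rewrite !inE => /orP[]/eqP-> //; rewrite mateK => /(ltn_trans lt_k).
    by rewrite ltnn.
  exists [set k; mate D k]; split.
  - by rewrite cards2 eq_sym mate_neq.
  - by move=> i; rewrite !inE (inj_eq (@mate_inj D)) (inv_eq (@mateK D)) orbC.
  - by move=> i j /openE iE /openE jE /iE-> /jE->; rewrite ltnn.
  - by move=> i /openE iE /iE->.
case/existsP=> l /and3P[ltlk lt_m /IHr[P [cardP mateP chainP topP]]].
have kP : k \notin P.
  by apply/negP => /topP/(_ lt_k)[]; rewrite leqNgt ltlk.
have mkP : mate D k \notin P by rewrite mateP.
have newtop i : i \in P -> (i < mate D i)%N -> (i < k)%N /\ (mate D k < mate D i)%N.
  move=> iP lt_i; have [le_il le_m] := topP _ iP lt_i.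
  by split; [apply: leq_ltn_trans ltlk | apply: leq_trans le_m].
have openE i : i \in k |: (mate D k |: P) -> (i < mate D i)%N -> i = k \/ i \in P.
  rewrite !inE => /or3P[/eqP->|/eqP->|->]; [by left| |by right].
  by rewrite mateK => /(ltn_trans lt_k); rewrite ltnn.
exists (k |: (mate D k |: P)); split.
- by rewrite !cardsU1 !inE mkP (negPf kP) orbF eq_sym mate_neq cardP [RHS]mulnS.
- by move=> i; rewrite !inE (inj_eq (@mate_inj D)) (inv_eq (@mateK D)) mateP orbCA.
- move=> i j iP jP lt_i lt_j lt_ij.
  case: (openE i iP lt_i) => iE; case: (openE j jP lt_j) => jE.
  + by move: lt_ij; rewrite iE jE ltnn.
  + by have [] := newtop j jE lt_j; rewrite -iE ltnNge (ltnW lt_ij).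
  + by rewrite jE; have [] := newtop i iE lt_i.
  + exact: chainP.
- move=> i iP lt_i; case: (openE i iP lt_i) => [->|iE] //.
  by have [/ltnW ? /ltnW ?] := newtop i iE lt_i.
Qed.

(* A nested set of arcs is lexicographically maximal among its rearrangements: at the
   first difference, [D] already joins the point to the last one available. *)
Lemma nested_rearrange_lt D (P : {set 'I_(2 * d)}) (s : 'S_(2 * d)) :
    (forall i, (mate D i \in P) = (i \in P)) ->
    {in P &, forall i j : 'I_(2 * d), (i < mate D i -> j < mate D j -> i < j ->
         mate D j < mate D i)%N} ->
    perm_on P s -> brauer_act D s != D ->
  (mate_word (brauer_act D s) < mate_word D)%O.
Proof.
move=> mateP chainP sP neD; apply: mate_word_lt => // k agree nek.
set E := brauer_act D s in agree nek *.
have {}agree (j : 'I_(2 * d)) : (j < k)%N -> mate D j = mate E j by move/agree.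
have [ltD ltE lt2] : [/\ (k < mate D k)%N, (k < mate E k)%N & (k < mate D (mate E k))%N].
  by apply: first_difference; rewrite // eq_sym.
have sVP := perm_onV sP.
have mateE i : i \notin P -> mate E i = mate D i.
  by move=> iP; rewrite mate_act (out_perm sP) // (out_perm sVP) // mateP.
have kP : k \in P by apply: contraR nek => /mateE ->.
have jP : mate E k \in P by rewrite mate_act (perm_closed _ sVP) mateP (perm_closed _ sP).
(* [mate E k] is a left or a right end of its arc in [D]. Both ends of that arc come after [k], so
   nesting places the whole arc before [mate D k]. *)
have [lt_j|le_j] := ltnP (mate E k) (mate D (mate E k)).
  by apply: (ltn_trans lt_j); apply: chainP.
have lt_j : (mate D (mate E k) < mate E k)%N by rewrite ltn_neqAle le_j val_eqE mate_neq.
have := chainP k (mate D (mate E k)) kP; rewrite mateP jP mateK.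
by apply.
Qed.

Lemma nested_bound D r k : nested D r k -> (r < d)%N.
Proof.
case/nested_setP=> P [cardP _ _ _]; have := max_card P.
by rewrite cardP card_ord leq_pmul2l.
Qed.

End Mate.

(** * Colouring arcs by nesting depth *)

Section Colour.
Variables (d n : nat) (D : brauer d).
Implicit Types (E : brauer d) (k l : 'I_(2 * d)).
Hypothesis not_nested : forall k, ~~ nested D n k.

(** The nesting depth of the arc through [k], outermost arcs having colour 0. It is read at the left
    end, so that both ends of an arc agree. *)
Definition colour (k : 'I_(2 * d)) : nat :=
  \max_(r < n | nested D r (if (k < mate D k)%N then k else mate D k)) r.

Lemma colour_mate k : colour (mate D k) = colour k.
Proof.
rewrite /colour mateK; congr (\max_(r < n | nested D r _) r).
by case: (ltngtP k (mate D k)) (mate_neq D k) => // /val_inj <-; rewrite eqxx.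
Qed.

Lemma nested_colour k : (k < mate D k)%N -> nested D (colour k) k /\ (colour k < n)%N.
Proof.
move=> lt_k; have n0 : (0 < n)%N.
  by rewrite lt0n; apply: contraNneq (not_nested k) => ->; rewrite /= lt_k.
rewrite /colour lt_k; have nk0 : nested D (Ordinal n0) k by rewrite /= lt_k.
have := @bigop.bigmax_eq_arg _ (Ordinal n0) (fun r : 'I_n => nested D r k) val nk0.
case: arg_maxnP => // r nr _ /= ->.
by split=> //; apply: ltn_ord.
Qed.

Lemma colour_lt k : (colour k < n)%N.
Proof.
have [/nested_colour[]//|] := ltnP k (mate D k).
rewrite leq_eqVlt val_eqE (negPf (mate_neq D k)) /= => lt_k.
by rewrite -colour_mate; apply: (nested_colour _).2; rewrite mateK.
Qed.

Lemma colour_nested k l : (k < l)%N -> (l < mate D l)%N ->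
  (mate D l < mate D k)%N -> (colour k < colour l)%N.
Proof.
move=> ltkl lt_l lt_m; have lt_k : (k < mate D k)%N.
  exact: ltn_trans ltkl (ltn_trans lt_l lt_m).
have [nk _] := nested_colour lt_k.
have nl : nested D (colour k).+1 l.
  by rewrite /= lt_l; apply/existsP; exists k; rewrite ltkl lt_m.
(* The maximum defining [colour l] runs over depths below [n] only; depth [n] itself is excluded by
   [not_nested]. *)
have ltc : ((colour k).+1 < n)%N.
  rewrite ltn_neqAle; apply/andP; split; last exact: colour_lt.
  by apply: contraTneq nl => ->; apply: not_nested.
rewrite {2}/colour lt_l.
exact: (@leq_bigmax_cond _ (fun r : 'I_n => nested D r l) val (Ordinal ltc)).
Qed.

(* Within one colour no arc of [D] encloses another, so [D] joins left ends to right ends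
   in increasing order, which is lexicographically minimal. *)
Lemma coloured_lt E : D != E ->
    (forall k, colour (mate E k) = colour k) ->
    (forall k, (mate E k < mate D (mate E k))%N != (k < mate D k)%N) ->
  (mate_word D < mate_word E)%O.
Proof.
move=> neDE colE openE; apply: mate_word_lt => // k agree nek.
have [ltD ltE lt2] := first_difference agree nek.
have := openE k; rewrite ltD eqb_id -leqNgt leq_eqVlt val_eqE (negPf (mate_neq _ _)) /=.
set j := mate E k in nek ltE lt2 * => lt_j.
rewrite ltnNge; apply/negP; rewrite leq_eqVlt eq_sym val_eqE (negPf nek) /= => lt_jk.
(* The arc of [D] ending at [j] would lie strictly inside the arc at [k], yet [j] has the colour of
   [k]. *)
have : (colour k < colour (mate D j))%N by apply: colour_nested; rewrite ?mateK.
by rewrite colour_mate colE ltnn.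
Qed.

End Colour.

(** * Values of kappa_D on pure tensors, and triangularity *)

Section KappaValues.
Variables (K : fieldType) (N d : nat) (form : {skew_symmetric 'rV[K]_N}).
Implicit Types (D E : brauer d).

(** Up to sign the value is the product of the form over the arcs of [D]; skew-symmetry makes the
    orientation of an arc irrelevant to vanishing. *)
Lemma kappa_diag_neq0P D (v : {ffun 'I_(2 * d) -> 'rV[K]_N}) :
  reflect (forall k : 'I_(2 * d), form (v k) (v (mate D k)) != 0)
          (vsval (kappa_diag form D) (pure v) != 0).
Proof.
set s := perm_of_brauer D.
have mateE i b : mate D ((s^-1)%g (pt i b)) = (s^-1)%g (pt i (~~ b)).
  by rewrite /mate permKV flip_ptE.
rewrite (@kappa_diagE _ _ _ _ D s) ?perm_of_brauerK // kappa_form_pure.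
rewrite mulf_eq0 signr_eq0 /=; apply: (iffP (prodf_neq0 _ _)) => nz.
  move=> k; have [[i b] skE] := ptP (s k).
  have -> : k = (s^-1)%g (pt i b) by rewrite -skE permK.
  by rewrite mateE; case: b {skE}; rewrite ?nz // herm_eq0C nz.
by move=> i _; have := nz ((s^-1)%g (pt i false)); rewrite mateE.
Qed.

Lemma kappa_separates n (b : nat -> bool -> 'rV[K]_N) D :
    (forall k k' e e', (k < n)%N -> (k' < n)%N ->
       (form (b k e) (b k' e') != 0) = (k == k') && (e != e')) ->
    (forall k, ~~ nested D n k) ->
  exists v, vsval (kappa_diag form D) (pure v) != 0 /\
    forall E, vsval (kappa_diag form E) (pure v) != 0 -> D != E ->
      (mate_word D < mate_word E)%O.
Proof.
move=> formE nnest.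
exists [ffun k => b (colour n D k) (k < mate D k)%N]; split=> [|E].
  apply/kappa_diag_neq0P => k; rewrite !ffunE formE ?colour_lt // colour_mate eqxx mateK.
  by case: (ltngtP k) (mate_neq D k) => // /val_inj <-; rewrite eqxx.
move/kappa_diag_neq0P => nzE neDE.
have nz (k : 'I_(2 * d)) : (colour n D k == colour n D (mate E k)) &&
      ((k < mate D k)%N != (mate E k < mate D (mate E k))%N).
  by have := nzE k; rewrite !ffunE formE ?colour_lt.
apply: (coloured_lt nnest neDE) => k; have /andP[/eqP e1 e2] := nz k => //.
by rewrite eq_sym.
Qed.

(** The system is triangular: on the tensor separating the largest diagram in the support of [a],
    every other term of [kappa d form a] vanishes. *)
Lemma kappa_free n (b : nat -> bool -> 'rV[K]_N) (a : {ffun brauer d -> K^o}) :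
    (forall k k' e e', (k < n)%N -> (k' < n)%N ->
       (form (b k e) (b k' e') != 0) = (k == k') && (e != e')) ->
    (forall D, a D != 0 -> forall k, ~~ nested D n k) ->
  kappa d form a = 0 -> a = 0.
Proof.
move=> formE nnest ka0; apply/eqP; apply/negPn/negP => a_neq0.
have [D0 aD0] : exists D, a D != 0.
  apply/existsP; apply: contraNT a_neq0 => /existsPn a0.
  by apply/eqP/ffunP => D; rewrite ffunE; apply/eqP/negPn/a0.
case: (@Order.TotalTheory.arg_maxP _ _ _ D0 (fun D => a D != 0) (@mate_word d) aD0) => D aD maxD.
have [v [nzD ltD]] := kappa_separates formE (nnest D aD).
have : vsval (kappa d form a) (pure v) = 0 by rewrite ka0 linear0 lfunE.
rewrite kappaE linear_sum sum_lfunE (bigD1 D) //= big1 => [|E neED].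
  rewrite addr0 scale_lfunE => /eqP; rewrite scaler_eq0 (negPf aD) => k0.
  by case/negP: nzD.
rewrite /= scale_lfunE; apply/eqP; rewrite scaler_eq0; apply/orP.
have [aE|aE] := boolP (a E == 0); [by left|right].
apply/negPn/negP => /ltD; rewrite eq_sym => /(_ neED).
by rewrite Order.TotalTheory.ltNge; apply/negP/negPn/(maxD E aE).
Qed.

End KappaValues.

(** * Orthogonal hyperbolic pairs for a skew form *)

Section HyperbolicFamily.
Variables (K : fieldType) (vT : vectType K) (form : {skew_symmetric vT}).
Hypothesis two_neq0 : 2%:R != 0 :> K.

Lemma skew_form_diag u : form u u = 0.
Proof.
have /eqP := hermC form u u; rewrite expr1 mulN1r -addr_eq0 -mulr2n.
by rewrite -mulr_natl mulf_eq0 (negPf two_neq0) => /eqP.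
Qed.

(** A pair is split off and the induction continues in its orthogonal complement inside [U], which
    loses at most two dimensions. Only non-vanishing matters later, so the pairs are not
    normalised. *)
Lemma hyperbolic_family m (U : {vspace vT}) : (2 * m <= \dim U)%N ->
    {in U, forall x : vT, x != 0 -> exists2 y, y \in U & form x y != 0} ->
  exists b : nat -> bool -> vT,
    (forall k e, (k < m)%N -> b k e \in U) /\
    forall k l e e', (k < m)%N -> (l < m)%N ->
      (form (b k e) (b l e') != 0) = (k == l) && (e != e').
Proof.
elim: m U => [|m IHm] U dimU nondegU; first by exists (fun _ _ => 0).
have U_neq0 : U != 0%VS by rewrite -dimv_eq0 -lt0n; apply: leq_trans dimU.
pose x := vpick U; have xU : x \in U by apply: memv_pick.
have [y yU nzxy] : exists2 y, y \in U & form x y != 0.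
  by apply: nondegU; rewrite // vpick0.
have nzyx : form y x != 0 by rewrite herm_eq0C.
pose W := (U :&: orthov form <[x]> :&: orthov form <[y]>)%VS.
have memW w : (w \in W) = [&& w \in U, form w x == 0 & form w y == 0].
  by rewrite !memv_cap !mem_orthov1 andbA.
have [] := IHm W.
- have ltU : (2 * m < \dim (U :&: orthov form <[x]>))%N.
    by apply: leq_trans (leq_dim_orthov1 form x U); rewrite ltn_predRL -addn2 addnC -mulnS.
  apply: leq_trans (leq_dim_orthov1 form y _).
  by rewrite -ltnS (ltn_predK ltU).
- move=> z; rewrite memW => /and3P[zU /eqP zx /eqP zy] z0.
  have [w wU nzw] := nondegU z zU z0.
  (* The projection of [w] to [W] along the plane of [x] and [y]; its pairing with [z] is unchanged,
     as [z] is orthogonal to both. *)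
  pose w' := w - (form w y / form x y) *: x - (form w x / form y x) *: y.
  exists w'.
    rewrite memW !rpredB ?rpredZ //= /w'; apply/andP; split; apply/eqP.
      by rewrite !linearBl !linearZl_LR /= skew_form_diag mulr0 subr0 divfK // subrr.
    by rewrite !linearBl !linearZl_LR /= skew_form_diag mulr0 subr0 divfK // subrr.
  by rewrite /w' !linearBr !linearZr_LR /= zx zy !mulr0 !subr0.
move=> b [bW formb].
exists (fun k e => if k is k'.+1 then b k' e else if e then y else x); split.
  case=> [|k] e lt_k; first by case: e.
  by have := bW k e lt_k; rewrite memW => /and3P[].
case=> [|k] [|l] e e' lt_k lt_l /=.
- by case: e e' => [] []; rewrite ?skew_form_diag ?eqxx.
- have := bW l e' lt_l; rewrite memW => /and3P[_ fx fy].
  by rewrite herm_eq0C; case: e; rewrite ?fx ?fy.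
- have := bW k e lt_k; rewrite memW => /and3P[_ fx fy].
  by case: e'; rewrite ?fx ?fy.
- by rewrite formb.
Qed.

End HyperbolicFamily.

(** * Validity of the relations, and straightening modulo them *)

Section Relations.
Variables (K : fieldType) (N d : nat) (form : {skew_symmetric 'rV[K]_N}).
Hypothesis pchar0 : [pchar K] =i pred0.

(** On a basis tensor two positions of [S] carry the same vector by pigeonhole. Multiplying by their
    transposition permutes the terms and changes each sign, so the sum equals its own negative. *)
Lemma kappa_relation (S : {set 'I_(2 * d)}) (D : brauer d) : (N < #|S|)%N ->
  \sum_(s in Sym S) kappa_diag form (brauer_act D s) = 0.
Proof.
move=> ltNS; apply: val_inj; rewrite /= linear_sum /=.
apply/lfunP => t; rewrite (tensor_decomp t) !linear_sum.
apply: eq_bigr => I _; rewrite !linearZ /= lfunE; congr (_ *: _).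
have [x xS [y yS [nexy eqI]]] : exists2 x, x \in S & exists2 y, y \in S & x != y /\ I x = I y.
  have /dinjectivePn : ~~ dinjectiveb I (mem S).
    apply: contraL ltNS => /dinjectiveP injI; rewrite -leqNgt -(card_in_imset injI).
    by rewrite -[X in (_ <= X)%N]card_ord max_card.
  case=> x xS [y /andP[neyx yS] eqI]; exists x => //; exists y => //; split=> //.
  by rewrite eq_sym.
pose tau := tperm x y; set v := basis_word K I.
have vtau k : v (tau k) = v k.
  by rewrite !ffunE /tau; case: tpermP => [->|->|//]; rewrite eqI.
have tauS : tau \in Sym S.
  rewrite inE; apply/subsetP => z; rewrite inE.
  by rewrite /tau; case: tpermP => [->|->|_ _]; rewrite ?eqxx.
pose F s : K := vsval (kappa_diag form (brauer_act D s)) (pure v).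
have FE s : F (tau * s)%g = - F s.
  rewrite /F; set r := perm_of_brauer D.
  have actE p : brauer_act D p = brauer_act (brauer0 d) (p * r)%g.
    by rewrite -{1}(perm_of_brauerK D) brauer_actM.
  rewrite !(kappa_diagE form (actE _)) !kappa_form_pure -mulNr; congr (_ * _).
    by rewrite -mulgA odd_permM odd_tperm nexy signr_addb mulN1r.
  apply: eq_bigr => i _.
  by rewrite -!mulgA !invMg !permM tpermV !vtau.
have sumF : \sum_(s in Sym S) F s = 0.
  apply/eqP; have /eqP : \sum_(s in Sym S) F s = - \sum_(s in Sym S) F s.
    rewrite {1}(reindex_inj (mulgI tau)) -sumrN; apply: eq_big => s.
      by rewrite groupMl.
    by rewrite FE.
  rewrite -addr_eq0 -mulr2n -mulr_natl mulf_eq0.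
  by case/orP=> //; rewrite ((pcharf0P K).1 pchar0).
by rewrite sum_lfunE.
Qed.

(** If [G] consists of the elements supported on diagrams without n + 1 nested arcs, then W + G is
    everything: a lexicographically minimal diagram outside W + G would be rewritten by a relation
    into smaller ones. *)
Lemma brauer_straightening n :
    let W := <<[seq brauer_relation X D |
                  X <- enum [set X : {set 'I_(2 * d)} | #|X| == (2 * n).+1],
                  D <- enum [set: brauer d]]>>%VS in
  forall a : {ffun brauer d -> K^o}, exists2 a', a - a' \in W &
    forall D, a' D != 0 -> forall k, ~~ nested D n k.
Proof.
move=> W.
pose good (D : brauer d) := [forall k, ~~ nested D n k].
have [G memG] : exists G : {vspace {ffun brauer d -> K^o}},
    forall f, f \in G <-> forall D, ~~ good D -> f D = 0.
  apply: vspace_of_prop => [D _|c f g f0 g0 D badD]; rewrite !ffunE //.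
  by rewrite f0 // g0 // scaler0 addr0.
have vecWG D : brauer_vec K D \in (W + G)%VS.
  apply/negPn/negP => badD.
  pose bad E := brauer_vec K E \notin (W + G)%VS.
  case: (@Order.TotalTheory.arg_minP _ _ _ D bad (@mate_word d) badD) => {badD} E badE minE.
  have ltE F : (mate_word F < mate_word E)%O -> brauer_vec K F \in (W + G)%VS.
    by apply: contraTT => /minE; rewrite Order.TotalTheory.ltNge negbK.
  case/negP: badE; have [gE|] := boolP (good E).
    apply: (subvP (addvSr W G)); apply/memG => F badF; rewrite ffunE.
    by case: eqP gE badF => // -> ->.
  rewrite negb_forall => /existsP[k /negPn /nested_setP[P [cardP mateP chainP _]]].
  have [x xP] : exists x, x \in P by apply/card_gt0P; rewrite cardP mulnS.
  (* Dropping any one of the 2n + 2 end points gives the size required of [S]; permutations of [S]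
     still preserve [P]. *)
  pose S := P :\ x.
  have cardS : #|S| = (2 * n).+1.
    by have := cardsD1 x P; rewrite xP cardP mulnS => -[].
  have relW : brauer_relation S E \in W.
    apply: memv_span; apply/allpairsP; exists (S, E).
    by rewrite !mem_enum !inE cardS eqxx.
  (* The order of the stabiliser of [E] in Sym(S), which is invertible in characteristic 0. *)
  pose c := #|[pred s in Sym S | brauer_act E s == E]|.
  have c0 : c%:R != 0 :> K.
    rewrite ((pcharf0P K).1 pchar0) -lt0n; apply/card_gt0P; exists 1%g.
    by rewrite inE group1 brauer_act1 eqxx.
  have relE : brauer_relation S E = c%:R *: brauer_vec K E +
      \sum_(s in Sym S | brauer_act E s != E) brauer_vec K (brauer_act E s).
    rewrite /brauer_relation (bigID (fun s => brauer_act E s == E)) /=; congr (_ + _).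
    rewrite (eq_bigr (fun=> brauer_vec K E)) => [|s /andP[_ /eqP->]] //.
    by rewrite sumr_const scaler_nat.
  have : c%:R *: brauer_vec K E \in (W + G)%VS.
    rewrite (canRL (addrK _) (esym relE)) rpredB //.
      exact: (subvP (addvSl W G)).
    apply: rpred_sum => s /andP[sS neE]; apply: ltE.
    apply: (nested_rearrange_lt mateP chainP) => //.
    move: sS; rewrite inE => /subset_trans; apply.
    exact: subD1set.
  by move/(rpredZ c%:R^-1); rewrite scalerK.
move=> a.
have : a \in (W + G)%VS.
  have -> : a = \sum_D (a D : K) *: brauer_vec K D.
    apply/ffunP => E; rewrite sum_ffunE (bigD1 E) //= !ffunE eqxx big1.
      by rewrite addr0 /GRing.scale /= mulr1.
    by move=> D neDE; rewrite !ffunE eq_sym (negPf neDE) scaler0.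
  by apply: rpred_sum => D _; apply: rpredZ.
case/memv_addP => w wW [a' a'G ->]; exists a'; first by rewrite addrK.
move=> D aD; suff /forallP : good D by [].
by apply: contraNT aD => badD; apply/eqP/(memG a').1.
Qed.

End Relations.

(** * The kernel of kappa over the complex numbers *)

Theorem theorem6p4 (R : realType) (n d : nat)
    (form : {skew_symmetric 'rV[R[i]]_(2 * n)})
    (form_nondeg : nondegenerate form) (d_ge1 : (1 <= d)%N) :
  ((d <= n)%N -> lker (kappa d form) = 0%VS)
  /\
  ((n.+1 <= d)%N ->
    (forall (S : {set 'I_(2 * d)}) (D : brauer d), #|S| = (2 * n).+1 ->
       \sum_(s in Sym S) kappa_diag form (brauer_act D s) = 0)
    /\
    (forall a : {ffun brauer d -> R[i]^o},
       \sum_D (a D : R[i]) *: kappa_diag form D = 0 ->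
       a \in <<[seq brauer_relation X D |
                  X <- enum [set X : {set 'I_(2 * d)} | #|X| == (2 * n).+1],
                  D <- enum [set: brauer d]]>>%VS)).
Proof.
have pchar0 : [pchar R[i]] =i pred0 by apply: Num.Theory.pchar_num.
have two_neq0 : 2%:R != 0 :> R[i] by rewrite ((pcharf0P _).1 pchar0).
have [b [_ formE]] : exists b : nat -> bool -> 'rV[R[i]]_(2 * n),
    (forall k e, (k < n)%N -> b k e \in fullv) /\
    forall k l e e', (k < n)%N -> (l < n)%N ->
      (form (b k e) (b l e') != 0) = (k == l) && (e != e').
  apply: hyperbolic_family => //; first by rewrite dimvf /dim /= mul1n.
  move=> x _ x0; have : x \notin orthov form fullv.
    by rewrite (eqP form_nondeg) memv0.
  by case/mem_orthovPn => y yV; exists y.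
split=> [le_dn|lt_nd].
  apply/eqP; rewrite -subv0; apply/subvP => a; rewrite memv_ker memv0 => /eqP ka0.
  (* A diagram with d arcs, d at most n, cannot contain n + 1 nested ones. *)
  apply/eqP/(kappa_free formE _ ka0) => D _ k.
  by apply: contraL le_dn => /nested_bound; rewrite -ltnNge.
split=> [S D cardS|a ka0]; first by apply: kappa_relation; rewrite // cardS.
have [a' aa'W nnest] := brauer_straightening pchar0 n a.
set W := <<_>>%VS in aa'W *.
have W_ker : (W <= lker (kappa d form))%VS.
  apply/span_subvP => _ /allpairsP[[S D] [/= Smem _ ->]].
  rewrite memv_ker /brauer_relation linear_sum /=.
  under eq_bigr do rewrite kappa_brauer_vec.
  by rewrite kappa_relation //; move: Smem; rewrite mem_enum inE => /eqP->.
(* Both [a] and [a - a'] lie in the kernel, hence so does [a'], whose support has no n + 1 nested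
   arcs. *)
have a'0 : a' = 0.
  apply: (kappa_free formE nnest); apply/eqP.
  have := subvP W_ker _ aa'W; rewrite memv_ker linearB /= kappaE ka0.
  by rewrite sub0r oppr_eq0.
by move: aa'W; rewrite a'0 subr0.
Qed.
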